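(* For all integers $r,s\ge 1$, $\chi_{ltna}(rK_2\vee C_{2s+1})=5$.
   Context: All graphs are finite and simple. $rK_2$ is the disjoint union of $r$ copies of $K_2$. $C_k$ is the cycle on $k$ vertices. The join $G\vee H$ of (vertex-disjoint) graphs has $V(G\vee H)=V(G)\cup V(H)$ and $E(G\vee H)=E(G)\cup E(H)\cup\{uv\mid u\in V(G),v\in V(H)\}$. For a graph $G=(V,E)$ of order $p$ and size $q$ without isolated vertices, a bijection $f:V\cup E\to\{1,\dots,p+q\}$ is a local total neighborhood antimagic labeling of $G$ if the induced vertex coloring $f^+_{tn}(u)=\sum_{ux\in E}[f(ux)+f(x)]$ satisfies $f^+_{tn}(u)\ne f^+_{tn}(v)$ for every edge $uv\in E$. The number of distinct induced colors is $c_{tn}(f)$. The local total neighborhood antimagic chromatic number $\chi_{ltna}(G)$ is the minimum of $c_{tn}(f)$ over all local total neighborhood antimagic labelings $f$ of $G$; an assertion $\chi_{ltna}(G)=k$ includes the assertion that $G$ admits such a labeling. *)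

(* Defs.v *)
From mathcomp Require Import all_boot.

Set Implicit Arguments.
Unset Strict Implicit.
Unset Printing Implicit Defensive.

Record sgraph := SGraph {
  vertex :> finType;
  adj : rel vertex;
  adj_sym : symmetric adj;
  adj_irr : irreflexive adj }.

Definition edges (G : sgraph) : {set {set G}} :=
  [set [set p.1; p.2] | p : G * G & adj p.1 p.2].

Definition no_isolated (G : sgraph) : Prop :=
  forall u : G, exists v : G, adj u v.

Section Complete.
Variable n : nat.
Definition complete_adj : rel 'I_n := fun i j => i != j.
Lemma complete_sym : symmetric complete_adj.
Proof. by move=> i j; rewrite /complete_adj eq_sym. Qed.
Lemma complete_irr : irreflexive complete_adj.
Proof. by move=> i; rewrite /complete_adj eqxx. Qed.
Definition complete : sgraph := SGraph complete_sym complete_irr.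
End Complete.

(* [ordS] is the successor modulo [n].  The conjunct [i != j] is redundant for
   [1 < n]; the graph is the cycle C_n exactly when [2 < n]. *)
Section Cycle.
Variable n : nat.
Definition cycle_adj : rel 'I_n :=
  fun i j => (i != j) && ((j == ordS i) || (i == ordS j)).
Lemma cycle_sym : symmetric cycle_adj.
Proof. by move=> i j; rewrite /cycle_adj eq_sym orbC. Qed.
Lemma cycle_irr : irreflexive cycle_adj.
Proof. by move=> i; rewrite /cycle_adj eqxx. Qed.
Definition cycle_graph : sgraph := SGraph cycle_sym cycle_irr.
End Cycle.

Section Copies.
Variables (r : nat) (G : sgraph).
Definition copies_adj : rel ('I_r * G) :=
  fun x y => (x.1 == y.1) && adj x.2 y.2.
Lemma copies_sym : symmetric copies_adj.
Proof. by move=> x y; rewrite /copies_adj eq_sym adj_sym. Qed.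
Lemma copies_irr : irreflexive copies_adj.
Proof. by move=> x; rewrite /copies_adj adj_irr andbF. Qed.
Definition copies : sgraph := SGraph copies_sym copies_irr.
End Copies.

Section Join.
Variables G H : sgraph.
Definition join_adj : rel (G + H) := fun x y =>
  match x, y with
  | inl u, inl v => adj u v
  | inr u, inr v => adj u v
  | _, _ => true
  end.
Lemma join_sym : symmetric join_adj.
Proof. by move=> [u|u] [v|v] //=; rewrite adj_sym. Qed.
Lemma join_irr : irreflexive join_adj.
Proof. by move=> [u|u] /=; rewrite adj_irr. Qed.
Definition join : sgraph := SGraph join_sym join_irr.
End Join.

Section Labeling.
Variable G : sgraph.

(* V \cup E, inside the sum of vertices and sets of vertices.  A labeling is
   total on [G + {set G}], but only its values on [elements] matter. *)
Definition elements : {set G + {set G}} :=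
  [set z | match z with inl _ => true | inr e => e \in edges G end].

Definition bijective_labeling (f : G + {set G} -> nat) : Prop :=
  {in elements &, injective f} /\
  (forall k : nat, (1 <= k <= #|G| + #|edges G|) <->
                   (exists2 z, z \in elements & f z = k)).

Definition tn_color (f : G + {set G} -> nat) (u : G) : nat :=
  \sum_(x : G | adj u x) (f (inr [set u; x]) + f (inl x)).

Definition ltn_antimagic (f : G + {set G} -> nat) : Prop :=
  bijective_labeling f /\
  (forall u v : G, adj u v -> tn_color f u <> tn_color f v).

Definition c_tn (f : G + {set G} -> nat) : nat :=
  size (undup [seq tn_color f u | u : G]).

(* The relation "chi_ltna(G) = k": the invariant is defined only for graphs
   without isolated vertices that admit such a labeling. *)
Definition chi_ltna_is (k : nat) : Prop :=
  [/\ no_isolated G,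
      exists2 f, ltn_antimagic f & c_tn f = k
    & forall f, ltn_antimagic f -> k <= c_tn f].

End Labeling.

(* Main.v *)
(* At least five colors are needed: the two ends of a K_2 and three vertices of
   the odd cycle that get pairwise distinct colors.

   Five suffice.  Write n = 2s+1, (i, 0) and (i, 1) for the ends of the i-th K_2,
   and let the join edges take the labels 1, ..., 2rn, the cycle the next 2n and
   rK_2 the last 3r.
   - Join edges at a cycle vertex j <> 0 are labeled in complementary pairs
     {k, 2rn+1-k} over each K_2, so all column sums agree; along a row the columns
     2k+1 and 2k+2 cancel up to a constant.  Column 0 gets the 2r middle labels,
     and its dependence on i is compensated by the labels of rK_2, which all
     decrease with i.  Hence the color of (i, a) depends only on a.
   - On the cycle the label y_j of vertex j is L - x_j, where x_j labels the edge
     from j to j+1.  The color of j is then a constant plus x_j - x_(j+1), and x is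
     chosen such that this difference is 2s+1 for even j < 2s, -(2s+2) for odd j
     and s for j = 2s.
   - Both matching colors exceed the cycle colors if r < s and are below them if
     r >= s. *)

Require Import Defs.
From mathcomp Require Import all_boot.
From mathcomp Require Import zify.

Set Implicit Arguments.
Unset Strict Implicit.
Unset Printing Implicit Defensive.

(** * Labelings given by weights, bijectivity, and counting colors *)

Section GraphLabelings.
Variable G : sgraph.

(** An edge is an unordered set, so its weight is read off an arbitrarily picked orientation; this
    is well defined when [w] is symmetric on adjacent pairs. The value 0 only occurs on sets that
    are not edges. *)
Definition weight_labeling (l : G -> nat) (w : G -> G -> nat)
    (z : G + {set G}) : nat :=
  match z with
  | inl u => l u
  | inr e =>
    if [pick p : G * G | adj p.1 p.2 && (e == [set p.1; p.2])] is Some p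
    then w p.1 p.2 else 0
  end.

Lemma set2_eq (T : finType) (a b c d : T) :
  [set a; b] = [set c; d] -> (a = c /\ b = d) \/ (a = d /\ b = c).
Proof.
move=> e.
have ha : a \in [set c; d] by rewrite -e set21.
have hb : b \in [set c; d] by rewrite -e set22.
have hc : c \in [set a; b] by rewrite e set21.
have hd : d \in [set a; b] by rewrite e set22.
move: ha hb hc hd; rewrite !in_set2.
by do 4![case/orP => /eqP ?]; subst; auto.
Qed.

Lemma weight_labeling_edge l w u v :
  (forall x y, adj x y -> w x y = w y x) -> adj u v ->
  weight_labeling l w (inr [set u; v]) = w u v.
Proof.
move=> w_sym uv /=; case: pickP => [[x y] /= /andP[xy /eqP/set2_eq]|/(_ (u, v))].
  by case=> -[-> ->] //; rewrite w_sym // adj_sym.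
by rewrite /= uv eqxx.
Qed.

Lemma card_elements : #|elements G| = #|G| + #|edges G|.
Proof.
have -> : elements G = (inl @: [set: G]) :|: (inr @: edges G).
  apply/setP => -[u|e]; rewrite !inE.
    by rewrite imset_f ?inE.
  apply/idP/orP => [eE|[/imsetP[]|/imsetP[x xE [->]]]] //.
  by right; rewrite imset_f.
rewrite cardsU disjoint_setI0 ?cards0 ?subn0.
  by rewrite (card_imset _ (@inl_inj _ _)) (card_imset _ (@inr_inj _ _)) cardsT.
rewrite -setI_eq0; apply/eqP/setP => z; rewrite !inE.
by apply/negP => /andP[/imsetP[u _ ->] /imsetP[]].
Qed.

(** Injectivity of [f \o g] forces [g] to be injective, so [P] has exactly as many members as there
    are elements; by pigeonhole the labels then fill the whole interval. *)
Lemma parametrized_bijective_labeling (P : finType) (g : P -> G + {set G})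
    (f : G + {set G} -> nat) :
  (forall p, g p \in elements G) ->
  (forall z, z \in elements G -> exists p, z = g p) ->
  injective (f \o g) -> (forall p, 1 <= f (g p) <= #|P|) ->
  bijective_labeling f.
Proof.
move=> gE g_surj fg_inj fg_bound.
have cardP : #|G| + #|edges G| = #|P|.
  have g_inj : injective g by move=> p q e; apply: fg_inj; rewrite /= e.
  rewrite -card_elements -(card_imset _ g_inj); apply: eq_card => z.
  by apply/idP/imsetP => [/g_surj[p ->]|[p _ ->]] //; exists p.
split.
  by move=> _ _ /g_surj[p ->] /g_surj[q ->] /fg_inj ->.
move=> k; rewrite cardP; split; last by case=> _ /g_surj[p ->] <-.
move=> k_bound.
have labels_uniq : uniq [seq f (g p) | p : P] by rewrite (map_inj_uniq fg_inj) enum_uniq.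
have labels_sub : {subset [seq f (g p) | p : P] <= iota 1 #|P|}.
  by move=> _ /mapP[p _ ->]; rewrite mem_iota; move: (fg_bound p); lia.
have [|_ labelsE] := uniq_min_size labels_uniq labels_sub.
  by rewrite size_iota size_map -cardE.
have /mapP[p _ ->] : k \in [seq f (g p) | p : P] by rewrite labelsE mem_iota; lia.
by exists (g p).
Qed.

Lemma leq_c_tn (f : G + {set G} -> nat) (s : seq G) :
  uniq [seq tn_color f u | u <- s] -> size s <= c_tn f.
Proof.
move=> s_uniq; rewrite -(size_map (tn_color f)); apply: uniq_leq_size => //.
by move=> _ /mapP[u _ ->]; rewrite mem_undup map_f ?mem_enum.
Qed.

Lemma c_tn_leq (f : G + {set G} -> nat) (s : seq nat) :
  (forall u, tn_color f u \in s) -> c_tn f <= size s.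
Proof.
move=> fs; apply: uniq_leq_size; first exact: undup_uniq.
by move=> k; rewrite mem_undup => /mapP[u _ ->].
Qed.

End GraphLabelings.

(** * Cyclic successors and colorings of odd cycles *)

Lemma val_ordS n (i : 'I_n) : ordS i = (if i.+1 == n then 0 else i.+1) :> nat.
Proof.
by have := ltn_ord i; rewrite /=; case: eqP => [->|ne lt_in]; rewrite ?modnn ?modn_small //; lia.
Qed.

Lemma val_ord_pred n (i : 'I_n) :
  ord_pred i = (if i == 0 :> nat then n.-1 else i.-1) :> nat.
Proof.
have := ltn_ord i; rewrite /=; case: eqP => [->|i_neq0] lt_in.
  by rewrite modn_small //; lia.
by rewrite (_ : (i + n).-1 = i.-1 + n) ?modnDr ?modn_small; lia.
Qed.

Lemma cycle_adjE n (i j : 'I_n) : 2 < n ->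
  adj (s := cycle_graph n) i j = (j == ordS i) || (j == ord_pred i).
Proof.
move=> n_gt2; rewrite /= /cycle_adj -!val_eqE /= -[_ %% _]/(ordS i : nat).
rewrite -[j.+1 %% _]/(ordS j : nat) -[_.-1 %% _]/(ord_pred i : nat).
rewrite !val_ordS val_ord_pred.
by have := ltn_ord i; have := ltn_ord j; do !case: eqP; lia.
Qed.

(** Otherwise [c] is invariant under steps of length 2. From 0, [s] such steps lead to 2s and one
    more wraps around to 1, so the neighbors 0 and 1 would share a color. *)
Lemma odd_cycle_three_colors s (c : 'I_(2 * s + 1) -> nat) : 1 <= s ->
  (forall i j, adj (s := cycle_graph (2 * s + 1)) i j -> c i <> c j) ->
  exists i, uniq [:: c i; c (ordS i); c (ordS (ordS i))].
Proof.
move=> s_gt0 c_proper; have n_gt0 : 0 < 2 * s + 1 by lia.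
have c_next i : c i <> c (ordS i) by apply: c_proper; rewrite cycle_adjE ?eqxx //; lia.
case: (pickP (fun i => c i != c (ordS (ordS i)))) => [i ci|same].
  exists i; rewrite /= !inE negb_or ci !andbT.
  by apply/andP; split; apply/eqP => //.
have evens k : c (iter k (fun i => ordS (ordS i)) (Ordinal n_gt0)) = c (Ordinal n_gt0).
  elim: k => //= k <-; apply/esym/eqP.
  by have := same (iter k (fun i => ordS (ordS i)) (Ordinal n_gt0)) => /negbFE.
case: (c_next (Ordinal n_gt0)); rewrite -(evens s.+1); congr c.
have iterE k : k <= s ->
    iter k (fun i => ordS (ordS i)) (Ordinal n_gt0) = 2 * k :> nat.
  elim: k => [|k IHk] k_le_s //; rewrite iterS !val_ordS IHk; last lia.
  by do !case: eqP; lia.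
apply: ord_inj; rewrite iterS !val_ordS iterE //=.
by do !case: eqP; lia.
Qed.

Lemma sum_cycle_adj n (i : 'I_n) (F : 'I_n -> nat) : 2 < n ->
  \sum_(j : 'I_n | adj (s := cycle_graph n) i j) F j
  = F (ordS i) + F (ord_pred i).
Proof.
move=> n_gt2.
have neq : ord_pred i != ordS i.
  apply/eqP => /(congr1 (@nat_of_ord n)); rewrite val_ordS val_ord_pred.
  by have := ltn_ord i; do !case: eqP; lia.
rewrite (eq_bigl _ _ (fun j => cycle_adjE i j n_gt2)).
rewrite (bigD1 (ordS i)) ?eqxx //= (bigD1 (ord_pred i)) ?eqxx ?orbT //=.
by rewrite big1 ?addn0 // => j; case: (j == _); case: (j == _).
Qed.

(** * The label formulas: ranges, injectivity and sums *)

Lemma edivn_inj r q q' i i' : i < r -> i' < r -> r * q + i = r * q' + i' ->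
  q = q' /\ i = i'.
Proof.
move=> lt_ir lt_i'r; rewrite !(mulnC r) => e.
have /(congr1 (edivn^~ r)) := e; rewrite !edivn_eq //.
by case.
Qed.

Section Labels.
Variables r s : nat.

(* The test is on [j' = j - 1]: end 0 gets the low label in odd columns, end 1 in
   even ones. *)
Definition join_edge_label (i a j : nat) : nat :=
  if j is j'.+1 then
    if odd j' == (a != 0) then r * j' + i + 1
    else 2 * r * (2 * s + 1) - (r * j' + i)
  else 2 * r * s + 2 * i + a + 1.

Definition cycle_middle := 2 * r * (2 * s + 1) + (2 * s + 1).

(** With M = [cycle_middle], odd j take the s lowest labels of the cycle block and even j the s+1
    labels just above M. The reflection k -> 2M+1-k of the block sends these to the remaining
    labels, which go to the vertices. *)
Definition cycle_edge_label (j : nat) : nat :=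
  if odd j then cycle_middle + j./2 - 2 * s else cycle_middle + 1 + j./2.

Definition cycle_vertex_label (j : nat) : nat :=
  2 * cycle_middle + 1 - cycle_edge_label j.

(** This and the two cases of [matching_vertex_label] are three consecutive runs of length r. *)
Definition matching_edge_label (i : nat) : nat :=
  2 * r * (2 * s + 1) + 2 * (2 * s + 1) + r - i.

Definition matching_vertex_label (i a : nat) : nat :=
  2 * r * (2 * s + 1) + 2 * (2 * s + 1) + (a + 2) * r - i.

(** Low labels stay at or below 2rs, and their complements lie above 2rs+2r; the 2r labels in
    between belong to column 0. *)
Lemma low_join_label_bound i j : i < r -> j < 2 * s -> r * j + i < 2 * r * s.
Proof.
move=> lt_ir lt_js; have : r * j.+1 <= r * (2 * s) by rewrite leq_mul2l lt_js orbT.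
by lia.
Qed.

Lemma join_edge_label_bound i a j : i < r -> a < 2 -> j < 2 * s + 1 ->
  0 < join_edge_label i a j <= 2 * r * (2 * s + 1).
Proof.
move=> lt_ir lt_a2; case: j => [|j] lt_jn /=; first by nia.
have lt_js : j < 2 * s by lia.
by have := low_join_label_bound lt_ir lt_js; case: ifP; lia.
Qed.

(** The low, middle and high ranges are disjoint. Inside the low or high range, division by r
    recovers the row and the column, and the parity test then gives the end. *)
Lemma join_edge_label_inj i a j i' a' j' :
  i < r -> a < 2 -> j < 2 * s + 1 -> i' < r -> a' < 2 -> j' < 2 * s + 1 ->
  join_edge_label i a j = join_edge_label i' a' j' ->
  [/\ i = i', a = a' & j = j'].
Proof.
move=> lt_ir lt_a2 lt_jn lt_i'r lt_a'2 lt_j'n.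
case: j lt_jn => [|j] lt_jn; case: j' lt_j'n => [|j'] lt_j'n /=.
- by move=> e; split=> //; lia.
- have lt_js : j' < 2 * s by lia.
  by move=> e; exfalso; have := low_join_label_bound lt_i'r lt_js; case: ifP e; lia.
- have lt_js : j < 2 * s by lia.
  by move=> e; exfalso; have := low_join_label_bound lt_ir lt_js; case: ifP e; lia.
have lt_js : j < 2 * s by lia.
have lt_j's : j' < 2 * s by lia.
have := low_join_label_bound lt_i'r lt_j's.
have := low_join_label_bound lt_ir lt_js.
move=> b b'; case: ifP => p; case: ifP => p' e; try by exfalso; lia.
  have /(edivn_inj lt_ir lt_i'r)[? ?] : r * j + i = r * j' + i' by lia.
  by subst; split=> //; lia.
have /(edivn_inj lt_ir lt_i'r)[? ?] : r * j + i = r * j' + i' by lia.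
by subst; split=> //; lia.
Qed.

Lemma cycle_edge_label_bound j : j < 2 * s + 1 ->
  2 * r * (2 * s + 1) < cycle_edge_label j
    <= 2 * r * (2 * s + 1) + 2 * (2 * s + 1).
Proof. by rewrite /cycle_edge_label /cycle_middle; case: ifP; lia. Qed.

Lemma cycle_vertex_label_bound j : j < 2 * s + 1 ->
  2 * r * (2 * s + 1) < cycle_vertex_label j
    <= 2 * r * (2 * s + 1) + 2 * (2 * s + 1).
Proof.
by rewrite /cycle_vertex_label /cycle_edge_label /cycle_middle; case: ifP; lia.
Qed.

Lemma cycle_edge_label_inj j j' : j < 2 * s + 1 -> j' < 2 * s + 1 ->
  cycle_edge_label j = cycle_edge_label j' -> j = j'.
Proof. by rewrite /cycle_edge_label /cycle_middle; do 2!case: ifP; lia. Qed.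

Lemma cycle_vertex_label_inj j j' : j < 2 * s + 1 -> j' < 2 * s + 1 ->
  cycle_vertex_label j = cycle_vertex_label j' -> j = j'.
Proof.
rewrite /cycle_vertex_label => lt_j lt_j' e; apply: cycle_edge_label_inj => //.
have := cycle_edge_label_bound lt_j; have := cycle_edge_label_bound lt_j'.
by rewrite /cycle_middle in e; lia.
Qed.

Lemma cycle_edge_vertex_label_neq j j' : j < 2 * s + 1 -> j' < 2 * s + 1 ->
  cycle_edge_label j <> cycle_vertex_label j'.
Proof.
by rewrite /cycle_vertex_label /cycle_edge_label /cycle_middle; do 2!case: ifP; lia.
Qed.

Lemma sum_odd_range (F : nat -> nat) :
  \sum_(j < 2 * s + 1) F j = F 0 + \sum_(k < s) (F (2 * k + 1) + F (2 * k + 2)).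
Proof.
elim: s => [|t IHt]; first by rewrite big_ord_recr !big_ord0 /= addnC.
rewrite (_ : 2 * t.+1 + 1 = (2 * t + 1).+2); last lia.
rewrite !big_ord_recr /= IHt -!addnA; congr (_ + (_ + _)).
by congr (F _ + F _); lia.
Qed.

(** Vertices 2k+1 and 2k+2 contribute 2M+2s-2k, where M is [cycle_middle]. The sum of the terms 2k
    stands on the left to avoid truncated subtraction. *)
Lemma sum_cycle_vertex_label :
  \sum_(j < 2 * s + 1) cycle_vertex_label j + s * s.-1
  = cycle_middle * (2 * s + 1) + 2 * s * s.
Proof.
rewrite sum_odd_range.
have -> : \sum_(k < s) (cycle_vertex_label (2 * k + 1) + cycle_vertex_label (2 * k + 2))
  = \sum_(k < s) (2 * cycle_middle + 2 * s - 2 * k).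
  apply: eq_bigr => k _; have := ltn_ord k.
  by rewrite /cycle_vertex_label /cycle_edge_label /cycle_middle; do 2!case: ifP; lia.
have sumE t : t <= s -> \sum_(k < t) (2 * cycle_middle + 2 * s - 2 * k) + t * t.-1
    = (2 * cycle_middle + 2 * s) * t.
  elim: t => [|t IHt] t_le_s; first by rewrite big_ord0 muln0.
  rewrite big_ord_recr /=.
  have := IHt (ltnW t_le_s).
  by case: t {IHt} t_le_s => [|t] /= t_le_s; nia.
have := sumE s (leqnn s).
by rewrite /cycle_vertex_label /cycle_edge_label /=; nia.
Qed.

(** Columns 2k+1 and 2k+2 hold one low and one high label, so i and k cancel and c-r (end 0) or c+r
    (end 1) remains. Only column 0 leaves a term 2i. *)
Lemma sum_join_edge_label i a : i < r -> a < 2 ->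
  \sum_(j < 2 * s + 1) join_edge_label i a j + (if a == 0 then s * r else 0)
  = 2 * r * s + 2 * i + a + 1 + s * (2 * r * (2 * s + 1) + 1) + (if a == 0 then 0 else s * r).
Proof.
move=> lt_ir lt_a2; rewrite sum_odd_range.
set c := 2 * r * (2 * s + 1) + 1.
have -> : \sum_(k < s) (join_edge_label i a (2 * k + 1) + join_edge_label i a (2 * k + 2))
  = \sum_(k < s) (if a == 0 then c - r else c + r).
  apply: eq_bigr => k _; have lt_ks := ltn_ord k.
  have b1 : 2 * k + 1 < 2 * s by lia.
  have := low_join_label_bound lt_ir b1.
  rewrite addn2 addn1 /= /c; do !case: eqP; lia.
rewrite sum_nat_const card_ord /= /c; case: eqP => _; nia.
Qed.

End Labels.

(** * Closed forms of the colors and their distinctness *)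

Section Colors.
Variables r s : nat.

Definition matching_color (a : nat) : nat :=
  matching_edge_label r s 0 + matching_vertex_label r s 0 (1 - a)
  + \sum_(j < 2 * s + 1) (join_edge_label r s 0 a j + cycle_vertex_label r s j).

(** The contribution of rK_2 to a cycle vertex: join edges average 2rn+1 per K_2, where n = 2s+1,
    and the subtracted term is the sum of the 2i in the vertex labels. *)
Definition column_sum : nat :=
  r * (2 * r * (2 * s + 1) + 1)
  + r * (2 * (2 * r * (2 * s + 1) + 2 * (2 * s + 1)) + 5 * r) - r * r.-1.

(** The two cycle neighbors and the edges to them give 2L plus the offset x_j - x_(j+1), with L = 2
    [cycle_middle] + 1; the negative offset is subtracted last. *)
Definition cycle_color (j : nat) : nat :=
  column_sum + 2 * (2 * cycle_middle r s + 1)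
  + (if j == 2 * s then s else if odd j then 0 else 2 * s + 1)
  - (if odd j then 2 * s + 2 else 0).

Lemma matching_colorE i a : i < r -> a < 2 ->
  matching_edge_label r s i + matching_vertex_label r s i (1 - a)
  + \sum_(j < 2 * s + 1) (join_edge_label r s i a j + cycle_vertex_label r s j)
  = matching_color a.
Proof.
move=> lt_ir lt_a2; have r_gt0 : 0 < r by lia.
rewrite /matching_color !big_split /=.
have := sum_join_edge_label s r_gt0 lt_a2; have := sum_join_edge_label s lt_ir lt_a2.
rewrite /matching_edge_label /matching_vertex_label.
by case: a lt_a2 => [|[|a]] //= _; lia.
Qed.

Lemma column_sumE j : j < 2 * s + 1 ->
  \sum_(i < r) (join_edge_label r s i 0 j + join_edge_label r s i 1 j
     + (matching_vertex_label r s i 0 + matching_vertex_label r s i 1))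
  = column_sum.
Proof.
move=> lt_jn; rewrite big_split /=.
have -> : \sum_(i < r) (join_edge_label r s i 0 j + join_edge_label r s i 1 j)
  = r * (2 * r * (2 * s + 1) + 1).
  case: j lt_jn => [|j] lt_jn.
    (* In column 0 the pair sums grow with i; only their total agrees with that of the other
       columns. *)
    have sumE t : \sum_(i < t) (join_edge_label r s i 0 0 + join_edge_label r s i 1 0)
       = t * (4 * r * s + 2 * t + 1).
      by elim: t => [|t IHt]; rewrite ?big_ord0 // big_ord_recr IHt /=; lia.
    by rewrite sumE; lia.
  rewrite -[X in X * _](card_ord r) -sum_nat_const; apply: eq_bigr => i _.
  have lt_js : j < 2 * s by lia.
  by have := low_join_label_bound (ltn_ord i) lt_js; rewrite /=; case: odd => /=; lia.
have sumE t : t <= r ->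
  \sum_(i < t) (matching_vertex_label r s i 0 + matching_vertex_label r s i 1) + t * t.-1
  = t * (2 * (2 * r * (2 * s + 1) + 2 * (2 * s + 1)) + 5 * r).
  elim: t => [|t IHt] t_le_r; first by rewrite big_ord0.
  rewrite big_ord_recr /=; have := IHt (ltnW t_le_r).
  rewrite /matching_vertex_label.
  by case: t {IHt} t_le_r => [|t] /= t_le_r; lia.
have := sumE r (leqnn r); rewrite /column_sum;
  set S := \sum_(_ < _) _; set q := r * r.-1; lia.
Qed.

(** The index [i] stands for the predecessor of [j]; its edge and vertex labels add up to a
    constant. *)
Lemma cycle_colorE j j' i : j < 2 * s + 1 -> j' = (if j == 2 * s then 0 else j.+1) ->
  i < 2 * s + 1 -> 0 < s ->
  column_sum + (cycle_edge_label r s j + cycle_vertex_label r s j'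
    + (cycle_edge_label r s i + cycle_vertex_label r s i)) = cycle_color j.
Proof.
move=> lt_jn -> lt_in s_gt0; rewrite /cycle_color.
have := cycle_edge_label_bound r lt_in.
rewrite [cycle_vertex_label r s i]/cycle_vertex_label => bi.
have -> : cycle_edge_label r s i + (2 * cycle_middle r s + 1 - cycle_edge_label r s i)
  = 2 * cycle_middle r s + 1 by rewrite /cycle_middle; lia.
rewrite /cycle_vertex_label /cycle_edge_label /cycle_middle.
case: eqP => [->|j_neq]; first by rewrite !oddM /=; do ?case: ifP; lia.
by do ?case: ifP; lia.
Qed.

(** The row of end 1 is larger by 2rs+1, while its partner's label is smaller by only r. *)
Lemma matching_color_neq : 0 < r -> 0 < s -> matching_color 0 <> matching_color 1.
Proof.
move=> r_gt0 s_gt0; rewrite /matching_color !big_split /=.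
have := sum_join_edge_label s r_gt0 (isT : 0 < 2).
have := sum_join_edge_label s r_gt0 (isT : 1 < 2).
by rewrite /matching_vertex_label /=; nia.
Qed.

(** The offsets 2s+1 and -(2s+2) alternate, and the closing vertex 2s has offset s, different from
    both. *)
Lemma cycle_color_neq j j' : 0 < s -> j < 2 * s + 1 ->
  j' = (if j == 2 * s then 0 else j.+1) -> cycle_color j <> cycle_color j'.
Proof.
move=> s_gt0 lt_jn ->; rewrite /cycle_color /cycle_middle.
case: (eqVneq j (2 * s)) => [->|j_neq]; first by rewrite !oddM /=; do !case: ifP; lia.
by do !case: ifP; lia.
Qed.

(* With [r = q + 1, s = q + t + 2] or [r = q + t + 1, s = q + 1], the difference of
   the two colors is a polynomial in [q] and [t] whose coefficients all have the
   same sign; [lia] only needs to be told that the monomials are nonnegative. *)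
Lemma matching_cycle_color_neq a j : 0 < r -> 0 < s -> a < 2 -> j < 2 * s + 1 ->
  matching_color a <> cycle_color j.
Proof.
move=> r_gt0 s_gt0 lt_a2 lt_jn e.
(* Only the range of the offset matters: [d] is the offset shifted by 2s+2, and [r * r.-1] undoes
   the subtraction in [column_sum]. *)
have [d d_le] : exists2 d, d <= 4 * s + 3 &
    cycle_color j + (2 * s + 2) + r * r.-1
    = r * (2 * r * (2 * s + 1) + 1)
      + r * (2 * (2 * r * (2 * s + 1) + 2 * (2 * s + 1)) + 5 * r)
      + 2 * (2 * cycle_middle r s + 1) + d.
  rewrite /cycle_color /column_sum /cycle_middle.
  have ? : r * r.-1 <= r * (5 * r) by rewrite leq_mul2l; lia.
  exists ((if j == 2 * s then s else if odd j then 0 else 2 * s + 1)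
          + (2 * s + 2 - if odd j then 2 * s + 2 else 0)); do !case: ifP; lia.
rewrite -e /matching_color big_split /= {e}.
have := sum_join_edge_label s r_gt0 lt_a2.
have := sum_cycle_vertex_label r s.
move: (\sum_(_ < _) _) (\sum_(_ < _) _) => S S'.
rewrite /matching_edge_label /matching_vertex_label /cycle_middle !subn0.
move: d_le; case: (ltnP r s) => [lt_rs|le_sr].
  have [q [t [-> ->]]] : exists q t, r = q + 1 /\ s = q + t + 2.
    by exists (r - 1), (s - r - 1); lia.
  rewrite (_ : (q + 1).-1 = q); last lia.
  rewrite (_ : (q + t + 2).-1 = q + t + 1); last lia.
  have := leq0n (q * t); have := leq0n (q * q); have := leq0n (t * t).
  have := leq0n (q * q * t); have := leq0n (q * t * t).
  by clear -lt_a2; case: a lt_a2 => [|[|a]] //= _; lia.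
have [q [t [-> ->]]] : exists q t, r = q + t + 1 /\ s = q + 1.
  by exists (s - 1), (r - s); lia.
rewrite (_ : (q + 1).-1 = q); last lia.
rewrite (_ : (q + t + 1).-1 = q + t); last lia.
have := leq0n (q * t); have := leq0n (q * q); have := leq0n (t * t).
have := leq0n (q * q * t); have := leq0n (q * t * t).
by clear -lt_a2; case: a lt_a2 => [|[|a]] //= _; lia.
Qed.

End Colors.

(** * The lower bound *)

Lemma five_le_c_tn r s f : 0 < r -> 0 < s ->
  ltn_antimagic (G := join (copies r (complete 2)) (cycle_graph (2 * s + 1))) f ->
  5 <= c_tn f.
Proof.
move=> r_gt0 s_gt0 [_ proper].
set G := join _ _ in f proper *.
have [|i] := @odd_cycle_three_colors s (fun i => tn_color f (inr i)) s_gt0.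
  by move=> i j ij; apply: proper.
set i1 := ordS i; set i2 := ordS i1 => cycle_uniq.
pose u (a : 'I_2) : G := inl (Ordinal r_gt0, a).
pose colors := [:: u ord0; u ord_max; inr i; inr i1; inr i2].
apply: (@leq_c_tn _ f colors).
rewrite [uniq _]/= -/(uniq [:: tn_color f (inr i); tn_color f (inr i1); tn_color f (inr i2)]).
rewrite cycle_uniq !inE !negb_or !andbT -!andbA.
(* The remaining pairs are all adjacent: the two ends of the K_2, and each end with each cycle
   vertex. *)
by do !(apply/andP; split); apply/eqP/proper; rewrite //= /copies_adj eqxx.
Qed.

(** * The labeling of the join *)

Section JoinLabeling.
Variables r s : nat.
Hypotheses (r_gt0 : 0 < r) (s_gt0 : 0 < s).

Let n := 2 * s + 1.
Let G := join (copies r (complete 2)) (cycle_graph n).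

Definition vertex_label (u : G) : nat :=
  match u with
  | inl x => matching_vertex_label r s x.1 (x.2 : 'I_2)
  | inr j => cycle_vertex_label r s (j : 'I_n)
  end.

(** A cycle edge is indexed by its tail, the endpoint whose successor is the other one; the tail is
    unique because n > 2. *)
Definition edge_label (u v : G) : nat :=
  match u, v with
  | inl x, inl _ => matching_edge_label r s x.1
  | inl x, inr j | inr j, inl x =>
      join_edge_label r s x.1 (x.2 : 'I_2) (j : 'I_n)
  | inr j, inr k =>
      cycle_edge_label r s (if k == ordS j then j : 'I_n else k : 'I_n)
  end.

Definition join_labeling := weight_labeling vertex_label edge_label.

Lemma join_cycle_adjE (j k : 'I_n) :
  adj (inr j : G) (inr k) = (k == ordS j) || (k == ord_pred j).
Proof. by apply: (@cycle_adjE n j k); rewrite /n; lia. Qed.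

Lemma edge_label_sym (u v : G) : adj u v -> edge_label u v = edge_label v u.
Proof.
case: u v => [x|j] [y|k] //; first by case/andP=> /eqP /= ->.
rewrite join_cycle_adjE => /orP[]/eqP -> /=; rewrite ?ord_predK !eqxx;
  case: eqP => // /(congr1 (@nat_of_ord n));
  rewrite !val_ordS ?val_ord_pred; have := ltn_ord j;
  by rewrite /n; do !case: eqP; lia.
Qed.

Lemma join_labeling_edge (u v : G) : adj u v ->
  join_labeling (inr [set u; v]) = edge_label u v.
Proof. by move=> uv; rewrite [LHS](weight_labeling_edge _ edge_label_sym uv). Qed.

(** * Bijectivity *)

Let param : finType := (G + 'I_r + 'I_n + 'I_r * 'I_2 * 'I_n)%type.

Definition param_element (p : param) : G + {set G} :=
  match p with
  | inl (inl (inl u)) => inl u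
  | inl (inl (inr i)) => inr [set (inl (i, ord0) : G); inl (i, ord_max)]
  | inl (inr j) => inr [set (inr j : G); inr (ordS j)]
  | inr (x, j) => inr [set (inl x : G); inr j]
  end.

Definition param_label (p : param) : nat :=
  match p with
  | inl (inl (inl u)) => vertex_label u
  | inl (inl (inr i)) => matching_edge_label r s i
  | inl (inr j) => cycle_edge_label r s j
  | inr (x, j) => join_edge_label r s x.1 x.2 j
  end.

Lemma param_elementP p : param_element p \in elements G.
Proof.
rewrite inE; case: p => [[[u|i]|j]|[x j]] //=.
- by apply/imsetP; exists (inl (i, ord0), inl (i, ord_max)); rewrite // inE /= /copies_adj eqxx.
- apply/imsetP; exists (inr j, inr (ordS j)); rewrite // inE.
  by rewrite join_cycle_adjE eqxx.
by apply/imsetP; exists (inl x, inr j); rewrite // inE.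
Qed.

Lemma param_label_elementE p : join_labeling (param_element p) = param_label p.
Proof.
case: p => [[[u|i]|j]|[x j]] //; rewrite [LHS]join_labeling_edge
  ?join_cycle_adjE ?eqxx //= ?/copies_adj ?eqxx //.
Qed.

Lemma param_element_surj z : z \in elements G -> exists p, z = param_element p.
Proof.
rewrite inE; case: z => [u _|e]; first by exists (inl (inl (inl u))).
case/imsetP => -[[x|j] [y|k]]; rewrite inE => uv -> {e}.
- case: x y uv => i a [i' b] /andP[/= /eqP <-]; rewrite /complete_adj => ab.
  exists (inl (inl (inr i))); congr inr => /=.
  have [[-> ->]|[-> ->]] : (a = ord0 /\ b = ord_max) \/ (a = ord_max /\ b = ord0).
    by move: a b ab => [[|[|?]] ?] [[|[|?]] ?] //= _; [left|right]; split; apply: val_inj.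
    by [].
  by rewrite setUC.
- by exists (inr (x, k)).
- by exists (inr (y, j)); rewrite /= setUC.
move: uv; rewrite join_cycle_adjE; case/orP => /eqP ->; first by exists (inl (inr j)).
by exists (inl (inr (ord_pred j))); rewrite /= ord_predK setUC.
Qed.

Lemma card_param : #|param| = 2 * r * n + 2 * n + 3 * r.
Proof. by rewrite !card_sum !card_prod !card_ord; lia. Qed.

Lemma param_label_bound p : 1 <= param_label p <= #|param|.
Proof.
rewrite card_param /n; case: p => [[[[[i a]|j]|i]|j]|[[i a] j]] /=.
- have := ltn_ord i; have := ltn_ord a; rewrite /matching_vertex_label.
  by case: (a : nat) => [|[|?]] //; lia.
- by have := cycle_vertex_label_bound r (ltn_ord j); lia.
- by have := ltn_ord i; rewrite /matching_edge_label; lia.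
- by have := cycle_edge_label_bound r (ltn_ord j); lia.
by have := join_edge_label_bound (ltn_ord i) (ltn_ord a) (ltn_ord j); lia.
Qed.

(** Numbers the four label intervals. The block can be read off the label, so injectivity need only
    be checked within a block; cycle vertices and cycle edges share one because their labels
    interleave. *)
Definition param_block (p : param) : nat :=
  match p with
  | inl (inl (inl (inl _))) => 3
  | inl (inl (inr _)) => 2
  | inl (inl (inl (inr _))) | inl (inr _) => 1
  | inr _ => 0
  end.

Lemma param_blockE p : param_block p =
  (2 * r * n < param_label p) + (2 * r * n + 2 * n < param_label p)
  + (2 * r * n + 2 * n + r < param_label p).
Proof.
rewrite /n; case: p => [[[[[i a]|j]|i]|j]|[[i a] j]] /=.
- by have := ltn_ord i; rewrite /matching_vertex_label; nia.
- by have := cycle_vertex_label_bound r (ltn_ord j); lia.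
- by have := ltn_ord i; rewrite /matching_edge_label; lia.
- by have := cycle_edge_label_bound r (ltn_ord j); lia.
by have := join_edge_label_bound (ltn_ord i) (ltn_ord a) (ltn_ord j); lia.
Qed.

Lemma matching_vertex_label_inj i a i' a' : i < r -> a < 2 -> i' < r -> a' < 2 ->
  matching_vertex_label r s i a = matching_vertex_label r s i' a' ->
  i = i' /\ a = a'.
Proof.
rewrite /matching_vertex_label => lt_ir.
by case: a => [|[|?]] // _; case: a' => [|[|?]] //; lia.
Qed.

Lemma param_label_inj : injective param_label.
Proof.
move=> p q e; have : param_block p = param_block q by rewrite !param_blockE e.
case: p e => [[[[[i a]|j]|i]|j]|[[i a] j]];
  case: q => [[[[[i' a']|j']|i']|j']|[[i' a'] j']] //= e _.
- have [e1 e2] := matching_vertex_label_inj (ltn_ord i) (ltn_ord a) (ltn_ord i') (ltn_ord a') e.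
  by rewrite (ord_inj e1) (ord_inj e2).
- by rewrite (ord_inj (cycle_vertex_label_inj (ltn_ord j) (ltn_ord j') e)).
- by case: (cycle_edge_vertex_label_neq (ltn_ord j') (ltn_ord j) (esym e)).
- have /ord_inj -> // : i = i' :> nat.
  by move: e (ltn_ord i) (ltn_ord i'); rewrite /matching_edge_label; lia.
- by case: (cycle_edge_vertex_label_neq (ltn_ord j) (ltn_ord j') e).
- by rewrite (ord_inj (cycle_edge_label_inj (ltn_ord j) (ltn_ord j') e)).
have [e1 e2 e3] := join_edge_label_inj (ltn_ord i) (ltn_ord a) (ltn_ord j)
  (ltn_ord i') (ltn_ord a') (ltn_ord j') e.
by rewrite (ord_inj e1) (ord_inj e2) (ord_inj e3).
Qed.

(** * The induced colors *)

Lemma tn_color_matching (i : 'I_r) (a : 'I_2) :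
  tn_color join_labeling (inl (i, a) : G) = matching_color r s a.
Proof.
rewrite /tn_color (eq_bigr (fun x => edge_label (inl (i, a) : G) x + vertex_label x));
  last by move=> x ux; rewrite join_labeling_edge.
rewrite big_sumType /= -(matching_colorE s (ltn_ord i) (ltn_ord a)); congr (_ + _).
(* [rev_ord] swaps the two ends, so [(i, rev_ord a)] is the only neighbor inside rK_2. *)
have other (b c : 'I_2) : (b != c) = (c == rev_ord b).
  by rewrite -!val_eqE; case: b c => [[|[|?]] ?] [[|[|?]] ?].
rewrite (big_pred1 (i, rev_ord a)) //= => -[i' b] /=.
by rewrite /copies_adj /= /complete_adj other -pair_eqE /= (eq_sym i).
Qed.

Lemma tn_color_cycle (j : 'I_n) :
  tn_color join_labeling (inr j : G) = cycle_color r s j.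
Proof.
rewrite /tn_color (eq_bigr (fun x => edge_label (inr j : G) x + vertex_label x));
  last by move=> x ux; rewrite join_labeling_edge.
rewrite big_sumType /= -(@cycle_colorE r s j (ordS j) (ord_pred j)) //; first last.
- by rewrite val_ordS /n; have := ltn_ord j; do !case: eqP; rewrite /n; lia.
congr (_ + _).
  rewrite -(@column_sumE r s j) // [LHS](_ : _ =
    \sum_(p : 'I_r * 'I_2) (join_edge_label r s p.1 p.2 j + matching_vertex_label r s p.1 p.2)) //.
  rewrite -(pair_bigA _ (fun (i : 'I_r) (a : 'I_2) =>
     join_edge_label r s i a j + matching_vertex_label r s i a)) /=.
  by apply: eq_bigr => i _; rewrite !big_ord_recl big_ord0 addn0 addnACA.
have n_gt2 : 2 < n by rewrite /n; lia.
rewrite [LHS](@sum_cycle_adj n j (fun k => cycle_edge_label r s (if k == ordS j then j else k)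
  + cycle_vertex_label r s k)) // eqxx ifN //.
apply/eqP => /(congr1 (@nat_of_ord n)); rewrite val_ordS val_ord_pred.
by have := ltn_ord j; do !case: eqP; lia.
Qed.

Lemma join_labeling_proper (u v : G) : adj u v ->
  tn_color join_labeling u <> tn_color join_labeling v.
Proof.
case: u v => [[i a]|j] [[i' b]|k]; rewrite ?tn_color_matching ?tn_color_cycle.
- case/andP=> _ /= ab; have := matching_color_neq r_gt0 s_gt0.
  by case: a b ab => [[|[|?]] ?] [[|[|?]] ?] //= _ neq // /esym.
- by move=> _; apply: matching_cycle_color_neq.
- by move=> _ /esym; apply: matching_cycle_color_neq.
rewrite join_cycle_adjE => /orP[]/eqP ->.
  by apply: cycle_color_neq => //; rewrite val_ordS /n; have := ltn_ord j; do !case: eqP; rewrite /n; lia.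
move/esym; apply: cycle_color_neq => //.
rewrite -{1}(ord_predK j) val_ordS; have := ltn_ord (ord_pred j); rewrite /n.
by do !case: eqP; lia.
Qed.

Lemma join_labeling_antimagic : ltn_antimagic join_labeling.
Proof.
split; last exact: join_labeling_proper.
apply: (parametrized_bijective_labeling param_elementP param_element_surj).
  by move=> p q; rewrite /= !param_label_elementE; apply: param_label_inj.
by move=> p; rewrite param_label_elementE; apply: param_label_bound.
Qed.

Lemma c_tn_join_labeling : c_tn join_labeling <= 5.
Proof.
(* A cycle color depends only on whether j = 2s and on the parity of j; 0, 1 and 2s represent the
   three cases. *)
apply: (@c_tn_leq _ _ [:: matching_color r s 0; matching_color r s 1;
  cycle_color r s 0; cycle_color r s 1; cycle_color r s (2 * s)]).
case=> [[i a]|j]; rewrite ?tn_color_matching ?tn_color_cycle !inE.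
  by case: a => [[|[|?]] ?]; rewrite //= eqxx ?orbT.
rewrite /cycle_color eqxx.
have /negbTE -> : 0 != 2 * s by lia.
have /negbTE -> : 1 != 2 * s by lia.
rewrite oddM /=; case: (eqVneq (j : nat) (2 * s)) => [->|_]; first by rewrite oddM eqxx !orbT.
by case: odd; rewrite eqxx ?orbT.
Qed.

End JoinLabeling.

Theorem theorem2p7 (r s : nat) (hr : 1 <= r) (hs : 1 <= s) :
  chi_ltna_is (join (copies r (complete 2)) (cycle_graph (2 * s + 1))) 5.
Proof.
split; last by move=> f; apply: five_le_c_tn.
- have n_gt0 : 0 < 2 * s + 1 by lia.
  case=> [x|j]; first by exists (inr (Ordinal n_gt0)).
  by exists (inl (Ordinal hr, ord0)).
exists (@join_labeling r s); first exact: join_labeling_antimagic.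
apply/eqP; rewrite eqn_leq c_tn_join_labeling //=.
by apply: five_le_c_tn => //; apply: join_labeling_antimagic.
Qed.
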